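(* Let $E_{\mathcal G}\rightrightarrows E_M$ be a VB-groupoid of rank $(l,k)$ over $\mathcal G\rightrightarrows M$ with core $C\to M$. Then the $s$-bisection frame bundle $\mathrm{Fr}^{\mathrm{sbis}}(E_{\mathcal G})$ is a (set-theoretical) groupoid over $\mathrm{Fr}(C)\times_M\mathrm{Fr}(E_M)$, with structure maps, for $(w,v)\in\mathbb R^l\times\mathbb R^k$: source: $\mathbf s(\phi_g)=(\mathbf s(\phi_g)^c,\mathbf s(\phi_g)^b)$, $\ \mathbf s(\phi_g)^c(w)=\tilde R_g\big(\tilde\tau(\phi_g(-w,d_{\phi_g}(w)))\big)$, $\ \mathbf s(\phi_g)^b(v)=\tilde s(\phi_g(0,v))$; target: $\mathbf t(\phi_g)=(\mathbf t(\phi_g)^c,\mathbf t(\phi_g)^b)$, $\ \mathbf t(\phi_g)^c(w)=\tilde R_{g^{-1}}(\phi_g(w,0))$, $\ \mathbf t(\phi_g)^b(v)=\tilde t(\phi_g(0,v))$; multiplication (for $\mathbf s(\phi_g)=\mathbf t(\phi_h)$): $\mathbf m(\phi_g,\phi_h)(w,v)=\tilde m\big(\phi_g(0,v),\phi_h(0,v)\big)+\tilde R_h(\phi_g(w,0))$; unit: $\mathbf u(\varphi^c_x,\varphi^b_x)(w,v)=\tilde u(\varphi^b_x(v))+\varphi^c_x(w)$; inverse: $\boldsymbol\tau(\phi_g)(w,v)=\tilde\tau\big(\phi_g(-w,v+d_{\phi_g}(w))\big)$.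
   Context: VB-groupoid of rank $(l,k)$ over a Lie groupoid $\mathcal G\rightrightarrows M$ (source $s$, target $t$, product $gh$ defined when $s(g)=t(h)$, units $1_x$): a Lie groupoid $E_{\mathcal G}\rightrightarrows E_M$ with structure maps $\tilde s,\tilde t,\tilde m,\tilde u,\tilde\tau$ (source, target, multiplication, unit, inverse), together with vector bundles $E_{\mathcal G}\to\mathcal G$ of rank $l+k$ and $E_M\to M$ of rank $k$, such that all structure maps are vector bundle morphisms over those of $\mathcal G\rightrightarrows M$. A subscript $g$, as in $\tilde s_g$, denotes restriction to the fibre $(E_{\mathcal G})_g$. Core: $C:=\{e\in E_{\mathcal G}: e\in (E_{\mathcal G})_{1_x}\text{ for some }x\in M,\ \tilde s(e)=0\}$, a vector bundle of rank $l$ over $M$. Core-anchor: $\rho:=\tilde t|_C:C\to E_M$. Right translation: for $g\in\mathcal G$, $\tilde R_g:=\tilde m(\cdot,0_g):\ker(\tilde s)|_{s^{-1}(t(g))}\to\ker(\tilde s)|_{s^{-1}(s(g))}$. Frames: for a vector bundle $E\to N$ of rank $r$, $\mathrm{Fr}(E)$ is the set of linear isomorphisms $\mathbb R^r\to E_x$, $x\in N$. $s$-bisection frame: a frame $\phi_g:\mathbb R^l\times\mathbb R^k\to(E_{\mathcal G})_g$ such that (1) $\phi_g(w,0)\in\ker(\tilde s_g)$ for all $w\in\mathbb R^l$; (2) $H_g:=\phi_g(\{0\}\times\mathbb R^k)$ satisfies $H_g\oplus\ker(\tilde s_g)=(E_{\mathcal G})_g=H_g\oplus\ker(\tilde t_g)$.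 The set of all of them is $\mathrm{Fr}^{\mathrm{sbis}}(E_{\mathcal G})$. For such $\phi_g$, the maps $\mathbf t(\phi_g)^b:\mathbb R^k\to(E_M)_{t(g)}$, $v\mapsto\tilde t(\phi_g(0,v))$, and $\mathbf t(\phi_g)^c:\mathbb R^l\to C_{t(g)}$, $w\mapsto\tilde R_{g^{-1}}(\phi_g(w,0))$, are linear isomorphisms, and $d_{\phi_g}:=(\mathbf t(\phi_g)^b)^{-1}\circ\rho_{t(g)}\circ\mathbf t(\phi_g)^c:\mathbb R^l\to\mathbb R^k$. *)

(* Defs.v *)
From HB Require Import structures.
From mathcomp Require Import all_boot all_order all_algebra.
From mathcomp Require Import all_classical all_reals all_analysis.
Import Order.TTheory GRing.Theory Num.Theory.
Import numFieldNormedType.Exports.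

Set Implicit Arguments.
Unset Strict Implicit.
Unset Printing Implicit Defensive.

Local Open Scope classical_set_scope.
Local Open Scope ring_scope.

(* The arrows are the elements of X, the objects those of O; mul g h is only
   meaningful when s g = t h. *)
Record is_groupoid (A B : Type) (X : set A) (O : set B) (s t : A -> B)
    (mul : A -> A -> A) (unt : B -> A) (inv : A -> A) : Prop := IsGroupoid {
  gpd_src_obj : forall g, X g -> O (s g) ;
  gpd_tgt_obj : forall g, X g -> O (t g) ;
  gpd_mul_arr : forall g h, X g -> X h -> s g = t h -> X (mul g h) ;
  gpd_unt_arr : forall x, O x -> X (unt x) ;
  gpd_inv_arr : forall g, X g -> X (inv g) ;
  gpd_src_mul : forall g h, X g -> X h -> s g = t h -> s (mul g h) = s h ;
  gpd_tgt_mul : forall g h, X g -> X h -> s g = t h -> t (mul g h) = t g ;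
  gpd_src_unt : forall x, O x -> s (unt x) = x ;
  gpd_tgt_unt : forall x, O x -> t (unt x) = x ;
  gpd_src_inv : forall g, X g -> s (inv g) = t g ;
  gpd_tgt_inv : forall g, X g -> t (inv g) = s g ;
  gpd_mulA : forall g h k, X g -> X h -> X k -> s g = t h -> s h = t k ->
    mul g (mul h k) = mul (mul g h) k ;
  gpd_mul1 : forall g, X g -> mul g (unt (s g)) = g ;
  gpd_1mul : forall g, X g -> mul (unt (t g)) g = g ;
  gpd_mulV : forall g, X g -> mul g (inv g) = unt (t g) ;
  gpd_mulVg : forall g, X g -> mul (inv g) g = unt (s g) }.

(* C^j maps on an open set U of R^m, by iterated directional derivatives. *)
Fixpoint is_Ck (R : realType) (m n j : nat) (U : set 'rV[R]_m)
    (f : 'rV[R]_m -> 'rV[R]_n) : Prop :=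
  if j is j'.+1 then
    forall v, (forall x, U x -> derivable f x v) /\
              is_Ck j' U (fun x => 'D_v f x)
  else forall x, U x -> {for x, continuous f}.

Definition is_Cinfty (R : realType) (m n : nat) (U : set 'rV[R]_m)
  (f : 'rV[R]_m -> 'rV[R]_n) : Prop := forall j, is_Ck j U f.

(* A chart is defined on cdom; cinv is its inverse on the image of cdom. *)
Record chart (R : realType) (T : Type) (n : nat) := Chart {
  cdom : set T ;
  cmap : T -> 'rV[R]_n ;
  cinv : 'rV[R]_n -> T }.

Definition cimg (R : realType) (T : Type) (n : nat) (c : chart R T n) :
  set 'rV[R]_n := cmap c @` cdom c.

Record is_chart (R : realType) (T : topologicalType) (n : nat)
    (c : chart R T n) : Prop := IsChart {
  chart_dom_open : open (cdom c) ;
  chart_img_open : open (cimg c) ;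
  chartK : forall x, cdom c x -> cinv c (cmap c x) = x ;
  chart_continuous : forall x, cdom c x -> {for x, continuous (cmap c)} ;
  chart_inv_continuous : forall y, cimg c y -> {for y, continuous (cinv c)} }.

Record is_smooth_atlas (R : realType) (T : topologicalType) (n : nat)
    (A : set (chart R T n)) : Prop := IsSmoothAtlas {
  atlas_chart : forall c, A c -> is_chart c ;
  atlas_cover : forall x, exists2 c, A c & cdom c x ;
  atlas_compat : forall c d, A c -> A d ->
    is_Cinfty (cmap c @` (cdom c `&` cdom d)) (cmap d \o cinv c) }.

(* Manifolds are pure-dimensional; Hausdorffness and second countability are
   imposed below, on the manifold of objects of a Lie groupoid only. *)
Record manifold (R : realType) (n : nat) := Manifold {
  mcarrier :> topologicalType ;
  atlas : set (chart R mcarrier n) ;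
  atlasP : is_smooth_atlas atlas }.

(* Smoothness of f on an open set W, with respect to two atlases. *)
Definition smooth_on (R : realType) (T S : topologicalType) (m n : nat)
    (A : set (chart R T m)) (B : set (chart R S n))
    (W : set T) (f : T -> S) : Prop :=
  (forall x, W x -> {for x, continuous f}) /\
  (forall c d, A c -> B d ->
     is_Cinfty (cmap c @` (W `&` cdom c `&` f @^-1` cdom d))
               (cmap d \o f \o cinv c)).

(* Smoothness of f along an embedded submanifold Z: locally, f is the
   restriction to Z of a smooth map on an open set of the ambient manifold. *)
Definition smooth_along (R : realType) (T S : topologicalType) (m n : nat)
    (A : set (chart R T m)) (B : set (chart R S n))
    (Z : set T) (f : T -> S) : Prop :=
  forall x, Z x -> exists W : set T, exists F : T -> S,
    [/\ open W, W x, smooth_on A B W F &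
        forall y, W y -> Z y -> F y = f y].

Definition smooth (R : realType) (m n : nat) (M : manifold R m)
  (N : manifold R n) (f : M -> N) : Prop :=
  smooth_on (@atlas R m M) (@atlas R n N) setT f.

Definition is_submersion (R : realType) (m n : nat) (M : manifold R m)
    (N : manifold R n) (f : M -> N) : Prop :=
  smooth f /\
  forall x c d, @atlas R m M c -> @atlas R n N d -> cdom c x -> cdom d (f x) ->
    forall y, exists v, 'D_v (cmap d \o f \o cinv c) (cmap c x) = y.

Definition prod_chart (R : realType) (T S : Type) (m n : nat)
    (c : chart R T m) (d : chart R S n) : chart R (T * S)%type (m + n) :=
  Chart (cdom c `*` cdom d)
        (fun x => row_mx (cmap c x.1) (cmap d x.2))
        (fun y => (cinv c (lsubmx y), cinv d (rsubmx y))).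

Definition prod_atlas (R : realType) (T S : Type) (m n : nat)
    (A : set (chart R T m)) (B : set (chart R S n)) :
    set (chart R (T * S)%type (m + n)) :=
  [set e | exists2 c, A c & exists2 d, B d & e = prod_chart c d].

Definition euclid_atlas (R : realType) (r : nat) :
  set (chart R 'rV[R]_r r) := [set Chart setT id id].

Definition composable (A B : Type) (s t : A -> B) : set (A * A) :=
  [set gh | s gh.1 = t gh.2].

(* As usual, the manifold of arrows is not required to be Hausdorff or second
   countable.  Since s and t are submersions, the composable pairs form an
   embedded submanifold of the product. *)
Record is_lie_groupoid (R : realType) (p n : nat) (A : manifold R p)
    (B : manifold R n) (s t : A -> B) (mul : A -> A -> A) (unt : B -> A)
    (inv : A -> A) : Prop := IsLieGroupoid {
  lie_groupoid_groupoid : is_groupoid setT setT s t mul unt inv ;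
  lie_groupoid_hausdorff : hausdorff_space B ;
  lie_groupoid_second_countable : @second_countable B ;
  lie_groupoid_src : is_submersion s ;
  lie_groupoid_tgt : is_submersion t ;
  lie_groupoid_mul :
    smooth_along (prod_atlas (@atlas R p A) (@atlas R p A)) (@atlas R p A)
                 (composable s t) (fun gh => mul gh.1 gh.2) ;
  lie_groupoid_unt : smooth unt ;
  lie_groupoid_inv : smooth inv }.

Record lie_groupoid (R : realType) (p n : nat) := LieGroupoid {
  arr : manifold R p ;
  obj : manifold R n ;
  gsrc : arr -> obj ;
  gtgt : arr -> obj ;
  gmul : arr -> arr -> arr ;
  gunt : obj -> arr ;
  ginv : arr -> arr ;
  lie_groupoidP : is_lie_groupoid gsrc gtgt gmul gunt ginv }.

(* A vector bundle is given by its total space; vadd e e' is only meaningful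
   when e and e' lie in the same fibre. *)
Record vector_bundle (R : realType) (n : nat) (N : manifold R n) (r : nat) :=
    VectorBundle {
  vtot :> manifold R (n + r) ;
  vproj : vtot -> N ;
  vzero : N -> vtot ;
  vadd : vtot -> vtot -> vtot ;
  vscale : R -> vtot -> vtot ;
  vproj_smooth : smooth vproj ;
  vproj_zero : forall x, vproj (vzero x) = x ;
  vproj_add : forall e e', vproj e = vproj e' -> vproj (vadd e e') = vproj e ;
  vproj_scale : forall a e, vproj (vscale a e) = vproj e ;
  vaddA : forall e e' e'', vproj e = vproj e' -> vproj e' = vproj e'' ->
    vadd e (vadd e' e'') = vadd (vadd e e') e'' ;
  vaddC : forall e e', vproj e = vproj e' -> vadd e e' = vadd e' e ;
  vadd0 : forall e, vadd e (vzero (vproj e)) = e ;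
  vaddN : forall e, vadd e (vscale (-1) e) = vzero (vproj e) ;
  vscaleA : forall a b e, vscale a (vscale b e) = vscale (a * b) e ;
  vscale1 : forall e, vscale 1 e = e ;
  vscaleDr : forall a e e', vproj e = vproj e' ->
    vscale a (vadd e e') = vadd (vscale a e) (vscale a e') ;
  vscaleDl : forall a b e,
    vscale (a + b) e = vadd (vscale a e) (vscale b e) ;
  (* e |-> (vproj e, theta e) is a fibrewise linear diffeomorphism from
     vproj @^-1` U to U * R^r, with inverse sigma *)
  local_triviality : forall x, exists U : set N,
    exists theta : vtot -> 'rV[R]_r, exists sigma : N * 'rV[R]_r -> vtot,
    [/\ open U /\ U x,
        smooth_on (@atlas R (n + r) vtot) (@euclid_atlas R r)
                  (vproj @^-1` U) theta,
        smooth_on (prod_atlas (@atlas R n N) (@euclid_atlas R r))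
                  (@atlas R (n + r) vtot) (U `*` setT) sigma,
        (forall y v, U y ->
           vproj (sigma (y, v)) = y /\ theta (sigma (y, v)) = v) /\
        (forall e, U (vproj e) -> sigma (vproj e, theta e) = e) &
        (forall e e', U (vproj e) -> vproj e = vproj e' ->
           theta (vadd e e') = theta e + theta e') /\
        (forall a e, U (vproj e) -> theta (vscale a e) = a *: theta e)] }.

Arguments vzero {R n N r} _ _.

Definition fibre (R : realType) (n : nat) (N : manifold R n) (r : nat)
  (E : vector_bundle N r) (x : N) : set E := [set e | vproj e = x].

Arguments fibre {R n N r} _ _.

(* Vector bundle morphism F over f (smoothness aside). *)
Record is_fibrewise_linear (R : realType) (n n' r r' : nat)
    (N : manifold R n) (N' : manifold R n') (E : vector_bundle N r)
    (E' : vector_bundle N' r') (f : N -> N') (F : E -> E') : Prop :=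
    IsFibrewiseLinear {
  linear_proj : forall e, vproj (F e) = f (vproj e) ;
  linear_add : forall e e', vproj e = vproj e' ->
    F (vadd e e') = vadd (F e) (F e') ;
  linear_scale : forall a e, F (vscale a e) = vscale a (F e) }.

(* phi is a linear isomorphism from V onto the linear subspace F of a fibre *)
Definition is_linear_iso (R : realType) (V : lmodType R) (n r : nat)
    (N : manifold R n) (E : vector_bundle N r) (F : set E) (phi : V -> E) :
    Prop :=
  (forall a u v, phi (a *: u + v) = vadd (vscale a (phi u)) (phi v)) /\
  set_bij setT F phi.

(* H (+) K = E_x, for H and K linear subspaces of E_x *)
Definition is_direct_sum (R : realType) (n r : nat) (N : manifold R n)
    (E : vector_bundle N r) (x : N) (H K : set E) : Prop :=
  [/\ [set vadd e.1 e.2 | e in H `*` K] = fibre E x &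
      H `&` K = [set vzero E x]].

Record vb_groupoid (R : realType) (p n : nat) (G : lie_groupoid R p n)
    (l k : nat) := VBGroupoid {
  EG : vector_bundle (arr G) (l + k) ;
  EM : vector_bundle (obj G) k ;
  vsrc : EG -> EM ;
  vtgt : EG -> EM ;
  vmul : EG -> EG -> EG ;
  vunt : EM -> EG ;
  vinv : EG -> EG ;
  vb_lie_groupoid : is_lie_groupoid vsrc vtgt vmul vunt vinv ;
  vsrc_linear : is_fibrewise_linear (@gsrc R p n G) vsrc ;
  vtgt_linear : is_fibrewise_linear (@gtgt R p n G) vtgt ;
  vunt_linear : is_fibrewise_linear (@gunt R p n G) vunt ;
  vinv_linear : is_fibrewise_linear (@ginv R p n G) vinv ;
  (* vmul is a vector bundle morphism over gmul, from the bundle of composable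
     pairs of EG to EG *)
  vmul_proj : forall e f, vsrc e = vtgt f ->
    vproj (vmul e f) = gmul (vproj e) (vproj f) ;
  vmul_add : forall e f e' f', vsrc e = vtgt f -> vsrc e' = vtgt f' ->
    vproj e = vproj e' -> vproj f = vproj f' ->
    vmul (vadd e e') (vadd f f') = vadd (vmul e f) (vmul e' f') ;
  vmul_scale : forall a e f, vsrc e = vtgt f ->
    vmul (vscale a e) (vscale a f) = vscale a (vmul e f) }.

Section SBisectionFrames.
Context (R : realType) (p n : nat) (G : lie_groupoid R p n) (l k : nat)
  (E : vb_groupoid G l k).

Local Notation g0 e := (vzero (EG E) e).
Local Notation m0 x := (vzero (EM E) x).

Definition ker_src (g : arr G) : set (EG E) :=
  [set e | fibre (EG E) g e /\ vsrc e = m0 (gsrc g)].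

Definition ker_tgt (g : arr G) : set (EG E) :=
  [set e | fibre (EG E) g e /\ vtgt e = m0 (gtgt g)].

(* The fibre C_x of the core; it lies in the fibre of EG over the unit at x. *)
Definition core (x : obj G) : set (EG E) :=
  [set e | fibre (EG E) (gunt x) e /\ vsrc e = m0 x].

Definition core_anchor (e : EG E) : EM E := vtgt e.

Definition Rtrans (g : arr G) (e : EG E) : EG E := vmul e (g0 g).

(* Fr(C) x_M Fr(E_M): a frame of C_x and a frame of (E_M)_x, for some x. *)
Definition Fr_core_base : set (('rV[R]_l -> EG E) * ('rV[R]_k -> EM E)) :=
  [set f | exists x, is_linear_iso (core x) f.1 /\
                     is_linear_iso (fibre (EM E) x) f.2].

(* A frame phi_g is a map into the total space of EG; it determines g, see
   frame_base. *)
Definition gframe : Type := ('rV[R]_l * 'rV[R]_k)%type -> EG E.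

Definition is_sbis_frame (g : arr G) (phi : gframe) : Prop :=
  let H := [set phi (0, v) | v in setT] in
  [/\ is_linear_iso (fibre (EG E) g) phi,
      forall w, ker_src g (phi (w, 0)),
      is_direct_sum g H (ker_src g) &
      is_direct_sum g H (ker_tgt g)].

Definition Fr_sbis : set gframe := [set phi | exists g, is_sbis_frame g phi].

Definition frame_base (phi : gframe) : arr G := vproj (phi 0).

Definition sbis_tgt_b (phi : gframe) (v : 'rV[R]_k) : EM E :=
  vtgt (phi (0, v)).

Definition sbis_tgt_c (phi : gframe) (w : 'rV[R]_l) : EG E :=
  Rtrans (ginv (frame_base phi)) (phi (w, 0)).

Definition sbis_tgt (phi : gframe) := (sbis_tgt_c phi, sbis_tgt_b phi).

(* d_phi = (t(phi)^b)^-1 \o rho \o t(phi)^c *)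
Definition sbis_d (phi : gframe) : 'rV[R]_l -> 'rV[R]_k :=
  'pinv_(fun=> 0) setT (sbis_tgt_b phi) \o core_anchor \o sbis_tgt_c phi.

Definition sbis_src_b (phi : gframe) (v : 'rV[R]_k) : EM E :=
  vsrc (phi (0, v)).

Definition sbis_src_c (phi : gframe) (w : 'rV[R]_l) : EG E :=
  Rtrans (frame_base phi) (vinv (phi (- w, sbis_d phi w))).

Definition sbis_src (phi : gframe) := (sbis_src_c phi, sbis_src_b phi).

Definition sbis_mul (phi psi : gframe) : gframe := fun wv =>
  vadd (vmul (phi (0, wv.2)) (psi (0, wv.2)))
       (Rtrans (frame_base psi) (phi (wv.1, 0))).

Definition sbis_unt (f : ('rV[R]_l -> EG E) * ('rV[R]_k -> EM E)) : gframe :=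
  fun wv => vadd (vunt (f.2 wv.2)) (f.1 wv.1).

Definition sbis_inv (phi : gframe) : gframe := fun wv =>
  vinv (phi (- wv.1, wv.2 + sbis_d phi wv.1)).

End SBisectionFrames.

Arguments Fr_sbis {R p n G l k} E _.
Arguments Fr_core_base {R p n G l k} E _.
Arguments sbis_src {R p n G l k} E _.
Arguments sbis_tgt {R p n G l k} E _.
Arguments sbis_mul {R p n G l k} E _.
Arguments sbis_unt {R p n G l k} E _.
Arguments sbis_inv {R p n G l k} E _.

(* Main.v *)
From HB Require Import structures.
From mathcomp Require Import all_boot all_order all_algebra.
From mathcomp Require Import all_classical reals topology.
Require Import Defs.
Import GRing.Theory.

Set Implicit Arguments.
Unset Strict Implicit.
Unset Printing Implicit Defensive.
Set Bullet Behavior "Strict Subproofs".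

Local Open Scope classical_set_scope.
Local Open Scope ring_scope.

(** Write a frame phi over g as the pair of its horizontal part
    a v = phi (0, v) and its vertical part b w = phi (w, 0), so that
    phi (w, v) = a v + b w.  Since the fibres of EM have dimension k, the two
    direct sum conditions say exactly that s o a and t o a are isomorphisms
    onto fibres of EM, and then b is forced to be an isomorphism from R^l onto
    ker s_g.  Hence s-bisection frames over g are the same thing as pairs (a, b)
    with these three isomorphism properties ([sbis_frame_pair],
    [frame_of_sbis]); the groupoid structure becomes transparent on pairs:

    - the product of (a, b) and (a', b') is (a . a', b . 0_h), and the unit at
      (f1, f2) is (u o f2, f1);
    - the core part of the target of (a, b) is b . 0_{g^-1};
    - the core part of the source looks asymmetric, being the right translate
      by g of tau (kappa w) with kappa w = a (d w) - b w.  Interchange of sums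
      and products ([Rtrans_inv_sub]) turns it into a (d w)^-1 . b w: it is the
      unique core element c with a (d w) . c = b w ([vmul_sbis_src_c],
      [sbis_src_c_unique]);
    - the inverse of (a, b) is (tau o a, tau o kappa), where kappa is an
      isomorphism from R^l onto ker t_g ([ker_tgt_frame_iso]).

    That a (d w) . c is defined means s (a (d w)) = t c: hence d is the
    core-anchor read in the source frames as well as in the target frames.  So composable frames
    have the same d, and so do a frame and its inverse.  With this, each
    groupoid axiom is checked separately on the horizontal and on the vertical
    parts, where it reduces to the corresponding axiom of the groupoid EG over
    EM; the one calculation of substance is that the source of a product is the
    source of its right factor ([sbis_src_mul]):
    a (d w) . a' (d w) . c' = a (d w) . b' w
                            = a (d w) . c . 0_h = b w . 0_h,
    where c and c' are the core parts at w of the sources of the left and right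
    factors, and b' w = c . 0_h is the core part of their composability. *)

(** * Groupoids all of whose elements are arrows *)

Section TotalGroupoid.
Variables (A B : Type) (s t : A -> B) (mul : A -> A -> A).
Variables (unt : B -> A) (inv : A -> A).
Hypothesis gpd : is_groupoid setT setT s t mul unt inv.

Lemma src_inv g : s (inv g) = t g. Proof. exact: (gpd_src_inv gpd). Qed.

Lemma tgt_inv g : t (inv g) = s g. Proof. exact: (gpd_tgt_inv gpd). Qed.

Lemma src_unt x : s (unt x) = x. Proof. exact: (gpd_src_unt gpd). Qed.

Lemma tgt_unt x : t (unt x) = x. Proof. exact: (gpd_tgt_unt gpd). Qed.

Lemma src_mul g h : s g = t h -> s (mul g h) = s h.
Proof. exact: (gpd_src_mul gpd). Qed.

Lemma tgt_mul g h : s g = t h -> t (mul g h) = t g.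
Proof. exact: (gpd_tgt_mul gpd). Qed.

Lemma mulA g h k : s g = t h -> s h = t k ->
  mul g (mul h k) = mul (mul g h) k.
Proof. exact: (gpd_mulA gpd). Qed.

Lemma mul_unt g x : s g = x -> mul g (unt x) = g.
Proof. by move=> <-; exact: (gpd_mul1 gpd). Qed.

Lemma unt_mul g x : t g = x -> mul (unt x) g = g.
Proof. by move=> <-; exact: (gpd_1mul gpd). Qed.

Lemma mul_inv g : mul g (inv g) = unt (t g).
Proof. exact: (gpd_mulV gpd). Qed.

Lemma inv_mul g : mul (inv g) g = unt (s g).
Proof. exact: (gpd_mulVg gpd). Qed.

Lemma mulK g h : s g = t h -> mul (mul g h) (inv h) = g.
Proof. by move=> gh; rewrite -mulA ?tgt_inv// mul_inv mul_unt. Qed.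

Lemma mulKg g h : s g = t h -> mul (inv g) (mul g h) = h.
Proof. by move=> gh; rewrite mulA ?src_inv// inv_mul unt_mul. Qed.

Lemma invK g : inv (inv g) = g.
Proof.
by rewrite -[LHS](@mul_unt _ (s g)) ?src_inv ?tgt_inv// -inv_mul mulKg
  ?src_inv.
Qed.

Lemma inv_unt x : inv (unt x) = unt x.
Proof.
by rewrite -[LHS](@mul_unt _ x) ?inv_mul ?src_unt// src_inv tgt_unt.
Qed.

(** The base identity behind [sbis_tgt_mul]: undoing the right translation by
    g h after that by h is undoing the one by g. *)
Lemma mul_inv_mul g h : s g = t h -> mul h (inv (mul g h)) = inv g.
Proof.
move=> gh; have i : t (inv (mul g h)) = s h by rewrite tgt_inv src_mul.
rewrite -[LHS](@mulKg g); last by rewrite tgt_mul.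
by rewrite [mul g _]mulA// mul_inv tgt_mul// mul_unt// src_inv.
Qed.

End TotalGroupoid.

(** * Linear maps into the fibres of a vector bundle *)

Section Fibres.
Variables (R : realType) (n : nat) (N : manifold R n) (r : nat).
Variable E : vector_bundle N r.
Implicit Types (e f : E) (x : N).

Definition vopp e : E := vscale (-1) e.

Lemma vproj_opp e : vproj (vopp e) = vproj e.
Proof. exact: vproj_scale. Qed.

Lemma vscale0 e : vscale 0 e = vzero E (vproj e).
Proof. by rewrite -[0](subrr (1 : R)) vscaleDl vscale1 vaddN. Qed.

Lemma vscale_zero a x : vscale a (vzero E x) = vzero E x.
Proof.
rewrite -[in LHS](vproj_zero E x) -vscale0 vscaleA mulr0 vscale0.
by rewrite vproj_zero.
Qed.

Lemma vadd_zero e x : vproj e = x -> vadd e (vzero E x) = e.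
Proof. by move=> <-; exact: vadd0. Qed.

Lemma zero_vadd e x : vproj e = x -> vadd (vzero E x) e = e.
Proof. by move=> ex; rewrite vaddC ?vproj_zero// vadd_zero. Qed.

Lemma vaddNr e : vadd e (vopp e) = vzero E (vproj e).
Proof. exact: vaddN. Qed.

Lemma vsubK e f : vproj e = vproj f -> vadd f (vadd e (vopp f)) = e.
Proof.
move=> ef; rewrite vaddC; last by rewrite vproj_add ?vproj_opp.
rewrite -vaddA ?vproj_opp// [vadd (vopp f) f]vaddC ?vproj_opp//.
by rewrite vaddNr vadd_zero.
Qed.

Lemma vsub_eq0 e f x : vproj e = x -> vproj f = x ->
  vadd e (vopp f) = vzero E x -> e = f.
Proof.
by move=> ex fx ef0; rewrite -[e](@vsubK e f) ?ef0 ?vadd_zero ?ex ?fx.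
Qed.

Lemma vopp0 x : vopp (vzero E x) = vzero E x.
Proof. exact: vscale_zero. Qed.

Lemma voppK e : vopp (vopp e) = e.
Proof. by rewrite /vopp vscaleA mulrNN mulr1 vscale1. Qed.

Lemma vaddACA e e' f f' x : vproj e = x -> vproj e' = x -> vproj f = x ->
  vproj f' = x -> vadd (vadd e e') (vadd f f') = vadd (vadd e f) (vadd e' f').
Proof.
move=> ex e'x fx f'x.
rewrite -!vaddA ?vproj_add ?ex ?e'x ?fx ?f'x//.
by congr vadd; rewrite !vaddA ?ex ?e'x ?fx ?f'x// (vaddC (e := e')) ?e'x ?fx.
Qed.

Section LinearMaps.
Variable V : lmodType R.
Implicit Types (phi : V -> E).

(** The base point x is part of the predicate because addition is only
    meaningful inside one fibre; unlike [is_linear_iso], no image is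
    prescribed. *)
Definition fibre_linear x phi :=
  (forall a u v, phi (a *: u + v) = vadd (vscale a (phi u)) (phi v)) /\
  forall u, vproj (phi u) = x.

Section Fixed.
Variables (x : N) (phi : V -> E).
Hypothesis phiL : fibre_linear x phi.

Lemma fibre_linearD u v : phi (u + v) = vadd (phi u) (phi v).
Proof. by rewrite -{1}[u]scale1r phiL.1 vscale1. Qed.

Lemma fibre_linear0 : phi 0 = vzero E x.
Proof.
have [lin px] := phiL.
(* linearity at -1, 0, 0 reads phi 0 = - phi 0 + phi 0 *)
have := lin (-1) 0 0; rewrite scaler0 addr0 vaddC ?vproj_scale//.
by rewrite vaddN px.
Qed.

Lemma fibre_linearZ a u : phi (a *: u) = vscale a (phi u).
Proof.
by rewrite -[a *: u]addr0 phiL.1 fibre_linear0 vadd_zero// vproj_scale phiL.2.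
Qed.

Lemma fibre_linearN u : phi (- u) = vopp (phi u).
Proof. by rewrite -scaleN1r fibre_linearZ. Qed.

Lemma fibre_linear_inj : (forall u, phi u = vzero E x -> u = 0) ->
  injective phi.
Proof.
move=> ker u v uv; apply/eqP; rewrite -subr_eq0; apply/eqP/ker.
by rewrite fibre_linearD fibre_linearN uv vaddNr phiL.2.
Qed.

Lemma fibre_linear_iso (F : set E) : (forall u, F (phi u)) ->
  (forall u, phi u = vzero E x -> u = 0) ->
  (forall e, F e -> exists u, phi u = e) -> is_linear_iso F phi.
Proof.
move=> sub ker surj; split; first exact: phiL.1.
split=> [u _|u v _ _|e /surj[u <-]]; [exact: sub| |by exists u].
exact: (fibre_linear_inj ker).
Qed.

End Fixed.

Section Iso.
Variables (x : N) (F : set E) (phi : V -> E).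
Hypotheses (subF : F `<=` fibre E x) (phiI : is_linear_iso F phi).

Lemma iso_fibre_linear : fibre_linear x phi.
Proof. by case: phiI => lin [im _ _]; split=> // u; apply: subF; apply: im. Qed.

Lemma iso_in u : F (phi u). Proof. by case: phiI => _ [im _ _]; apply: im. Qed.

Lemma iso_inj : injective phi.
Proof. by case: phiI => _ [_ inj _] u v uv; apply: inj; rewrite ?inE. Qed.

Lemma iso_surj e : F e -> exists u, phi u = e.
Proof. by case: phiI => _ [_ _ surj] /surj[u _ <-]; exists u. Qed.

Lemma iso_ker u : phi u = vzero E x -> u = 0.
Proof. by rewrite -(fibre_linear0 iso_fibre_linear) => /iso_inj. Qed.

End Iso.
End LinearMaps.

(** A local trivialisation turns phi into an injective endomorphism of R^r,
    hence into an invertible square matrix.  The rank of the bundle enters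
    only here. *)
Lemma fibre_linear_rank_iso x (phi : 'rV[R]_r -> E) : fibre_linear x phi ->
  (forall v, phi v = vzero E x -> v = 0) -> is_linear_iso (fibre E x) phi.
Proof.
move=> phiL ker; apply: (fibre_linear_iso phiL) => // [u|e ex].
  exact: phiL.2.
have [U [theta [sigma [[_ Ux] _ _ [_ sK] [thD thZ]]]]] := local_triviality E x.
have Up e' : vproj e' = x -> U (vproj e') by move=> ->.
have thI e1 e2 : vproj e1 = x -> vproj e2 = x -> theta e1 = theta e2 -> e1 = e2.
  move=> e1x e2x th.
  by rewrite -(sK e1 (Up _ e1x)) -(sK e2 (Up _ e2x)) th e1x e2x.
have linF : linear (theta \o phi).
  move=> a u v /=; rewrite phiL.1 thD ?vproj_scale ?phiL.2//.
  by rewrite thZ ?phiL.2.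
pose FL := GRing.isLinear.Build _ _ _ _ (theta \o phi) linF.
pose F : {linear 'rV[R]_r -> 'rV[R]_r} := HB.pack (theta \o phi) FL.
have FE v : v *m lin1_mx F = theta (phi v) by rewrite mul_rV_lin1.
have th0 : theta (vzero E x) = 0.
  by rewrite -(fibre_linear0 phiL) -FE mul0mx.
have M1 : lin1_mx F \in unitmx.
  rewrite -row_free_unit; apply: inj_row_free => v; rewrite FE => v0.
  by apply: ker; apply: thI; rewrite ?phiL.2 ?vproj_zero// v0 th0.
exists (theta e *m invmx (lin1_mx F)).
by apply: thI; rewrite ?phiL.2// -FE mulmxKV.
Qed.

End Fibres.

Arguments vopp {R n N r E} e.

Section BundleMaps.
Variables (R : realType) (n n' r r' : nat).
Variables (N : manifold R n) (N' : manifold R n').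
Variables (E : vector_bundle N r) (E' : vector_bundle N' r').
Variables (f : N -> N') (F : E -> E').
Hypothesis FL : is_fibrewise_linear f F.

Lemma fibrewise_linear0 x : F (vzero E x) = vzero E' (f x).
Proof.
rewrite -{1}(vproj_zero E x) -vscale0 (linear_scale FL) vscale0.
by rewrite (linear_proj FL) vproj_zero.
Qed.

Lemma fibrewise_linearN e : F (vopp e) = vopp (F e).
Proof. exact: (linear_scale FL). Qed.

Lemma fibre_linear_comp (V : lmodType R) x (phi : V -> E) :
  fibre_linear x phi -> fibre_linear (f x) (F \o phi).
Proof.
move=> [lin px]; split=> [a u v|u] /=; last by rewrite (linear_proj FL) px.
by rewrite lin (linear_add FL) ?vproj_scale ?px// (linear_scale FL).
Qed.

End BundleMaps.

(** * Zeros and right translations in a VB-groupoid *)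

Section VBGroupoid.
Variables (R : realType) (p n : nat) (G : lie_groupoid R p n) (l k : nat).
Variable E : vb_groupoid G l k.
Implicit Types (g h j : arr G) (e f : EG E).

Local Notation g0 g := (vzero (EG E) g).
Local Notation m0 x := (vzero (EM E) x).

Local Notation vsrc := (@vsrc R p n G l k E).
Local Notation vtgt := (@vtgt R p n G l k E).
Local Notation vinv := (@vinv R p n G l k E).
Local Notation vunt := (@vunt R p n G l k E).

Let gpdG := lie_groupoid_groupoid (lie_groupoidP G).
Let gpdE := lie_groupoid_groupoid (vb_lie_groupoid E).
Let srcL := vsrc_linear E.
Let tgtL := vtgt_linear E.
Let invL := vinv_linear E.

Lemma vsrc_zero g : vsrc (g0 g) = m0 (gsrc g).
Proof. exact: (fibrewise_linear0 srcL). Qed.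

Lemma vtgt_zero g : vtgt (g0 g) = m0 (gtgt g).
Proof. exact: (fibrewise_linear0 tgtL). Qed.

Lemma vunt_zero x : vunt (m0 x) = g0 (gunt x).
Proof. exact: (fibrewise_linear0 (vunt_linear E)). Qed.

Lemma vmul_zero g h : gsrc g = gtgt h -> vmul (g0 g) (g0 h) = g0 (gmul g h).
Proof.
move=> gh; have zz : vsrc (g0 g) = vtgt (g0 h).
  by rewrite vsrc_zero vtgt_zero gh.
rewrite -[in LHS](vscale_zero _ 0 g) -[in LHS](vscale_zero _ 0 h).
by rewrite vmul_scale// vscale0 vmul_proj// !vproj_zero.
Qed.

Lemma core_ker_src x : core x = ker_src (gunt x) :> set (EG E).
Proof. by rewrite /core /ker_src (src_unt gpdG). Qed.

Lemma Rtrans_composable g h e : ker_src g e -> gsrc g = gtgt h ->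
  vsrc e = vtgt (g0 h).
Proof. by case=> _ -> ->; rewrite vtgt_zero. Qed.

Lemma Rtrans_ker_src g h e : ker_src g e -> gsrc g = gtgt h ->
  ker_src (gmul g h) (Rtrans h e).
Proof.
move=> eg gh; have eh := Rtrans_composable eg gh.
split; first by rewrite /fibre /= vmul_proj// eg.1 vproj_zero.
by rewrite (src_mul gpdE)// (src_mul gpdG)// vsrc_zero.
Qed.

Lemma vtgt_Rtrans g h e : ker_src g e -> gsrc g = gtgt h ->
  vtgt (Rtrans h e) = vtgt e.
Proof.
by move=> eg gh; rewrite (tgt_mul gpdE)//; exact: Rtrans_composable gh.
Qed.

Lemma Rtrans_comp g h j e : ker_src g e -> gsrc g = gtgt h ->
  gsrc h = gtgt j -> Rtrans j (Rtrans h e) = Rtrans (gmul h j) e.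
Proof.
move=> eg gh hj; rewrite /Rtrans -(mulA gpdE) ?vmul_zero//.
  exact: Rtrans_composable gh.
by rewrite vsrc_zero vtgt_zero hj.
Qed.

Lemma Rtrans_unt g x e : ker_src g e -> gsrc g = x -> Rtrans (gunt x) e = e.
Proof. by move=> [_ se] <-; rewrite /Rtrans -vunt_zero (mul_unt gpdE). Qed.

Lemma Rtrans_inv g e : ker_src g e -> Rtrans g (Rtrans (ginv g) e) = e.
Proof.
move=> eg; rewrite (Rtrans_comp eg) ?(tgt_inv gpdG) ?(src_inv gpdG)//.
by rewrite (inv_mul gpdG) (Rtrans_unt eg).
Qed.

Lemma Rtrans_invV g h e : ker_src g e -> gsrc g = gtgt h ->
  Rtrans (ginv h) (Rtrans h e) = e.
Proof.
move=> eg gh; rewrite (Rtrans_comp eg) ?(tgt_inv gpdG)//.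
by rewrite (mul_inv gpdG) (Rtrans_unt eg).
Qed.

(** Right translation by h is inverted by right translation by h^-1, and it is
    linear because 0_h may be split as a 0_h + 0_h before interchanging. *)
Lemma Rtrans_iso (V : lmodType R) g h (b : V -> EG E) :
  is_linear_iso (ker_src g) b -> gsrc g = gtgt h ->
  is_linear_iso (ker_src (gmul g h)) (Rtrans h \o b).
Proof.
move=> bI gh.
have bL : fibre_linear g b by apply: (iso_fibre_linear _ bI) => e [].
have bg := iso_in bI; have bh w := Rtrans_composable (bg w) gh.
have RL : fibre_linear (gmul g h) (Rtrans h \o b).
  split=> [a u v|u]; last by have [] := Rtrans_ker_src (bg u) gh.
  have sc : vsrc (vscale a (b u)) = vtgt (vscale a (g0 h)).
    by rewrite (linear_scale srcL) (linear_scale tgtL) bh.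
  have zE : vadd (vscale a (g0 h)) (g0 h) = g0 h.
    by rewrite vscale_zero vadd_zero ?vproj_zero.
  rewrite /= bL.1 /Rtrans -[in LHS]zE.
  by rewrite vmul_add ?vproj_scale ?vproj_zero ?bL.2// vmul_scale.
apply: (fibre_linear_iso RL) => [u|u /= u0|e eg].
- exact: Rtrans_ker_src.
- apply: (iso_ker (x := g) _ bI) => [e []//|].
  rewrite -(Rtrans_invV (bg u) gh) u0 /Rtrans vmul_zero.
    by rewrite (mulK gpdG).
  by rewrite (src_mul gpdG)// (tgt_inv gpdG).
- have hh : gsrc (gmul g h) = gtgt (ginv h).
    by rewrite (src_mul gpdG)// (tgt_inv gpdG).
  have := Rtrans_ker_src eg hh; rewrite (mulK gpdG)// => /(iso_surj bI)[w bw].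
  exists w; rewrite /= bw (Rtrans_comp eg hh) ?(src_inv gpdG)//.
  by rewrite (inv_mul gpdG) (Rtrans_unt eg)// (src_mul gpdG).
Qed.

(** Writing 0_g as f - f, interchange gives
    (e^-1 - f^-1) . (f - f) = e^-1 . f - f^-1 . f, and f^-1 . f is the unit
    at s f = 0, which is a zero vector. *)
Lemma Rtrans_inv_sub g e f : vproj e = g -> ker_src g f -> vtgt e = vtgt f ->
  Rtrans g (vinv (vadd e (vopp f))) = vmul (vinv e) f.
Proof.
move=> eg [fg sf] ef.
have ev : vsrc (vinv e) = vtgt f by rewrite (src_inv gpdE).
have fv : vsrc (vinv f) = vtgt f by rewrite (src_inv gpdE).
rewrite (linear_add invL) ?vproj_opp ?fg// (fibrewise_linearN invL).
rewrite /Rtrans -fg -vaddNr vmul_add ?vproj_opp ?(linear_proj invL) ?eg ?fg//.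
  rewrite vmul_scale// (inv_mul gpdE) sf vunt_zero vscale_zero vadd_zero//.
  by rewrite vmul_proj// (linear_proj invL) eg fg (inv_mul gpdG).
by rewrite (fibrewise_linearN srcL) (fibrewise_linearN tgtL) fv.
Qed.

(** * Frames as pairs of a horizontal and a vertical part *)

Definition frame_of (a : 'rV[R]_k -> EG E) (b : 'rV[R]_l -> EG E) : gframe E :=
  fun wv => vadd (a wv.2) (b wv.1).

(** For TG over TM, the horizontal space a (R^k) is the tangent plane of a local
    bisection through g: it is a common complement of ker s_g and ker t_g. *)
Definition bisection_pair g (a : 'rV[R]_k -> EG E) (b : 'rV[R]_l -> EG E) :=
  [/\ fibre_linear g a, is_linear_iso (ker_src g) b,
      is_linear_iso (fibre (EM E) (gsrc g)) (vsrc \o a) &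
      is_linear_iso (fibre (EM E) (gtgt g)) (vtgt \o a)].

(** Stated for any fibrewise linear F, so as to serve for both the source and
    the target.  If F o a is an isomorphism, a vector e splits off the unique
    a v with F (a v) = F e; conversely a complement of ker F meets it trivially,
    so F o a is injective and a dimension count concludes. *)
Lemma direct_sum_ker g (f : arr G -> obj G) (F : EG E -> EM E)
    (a : 'rV[R]_k -> EG E) : is_fibrewise_linear f F -> fibre_linear g a ->
  is_linear_iso (fibre (EM E) (f g)) (F \o a) <->
  injective a /\ is_direct_sum g [set a v | v in setT]
    [set e | fibre (EG E) g e /\ F e = m0 (f g)].
Proof.
move=> FL aL; have FaL := fibre_linear_comp FL aL; split=> [FaI|[aI [_ HK]]].
- have Fsub : fibre (EM E) (f g) `<=` fibre (EM E) (f g) by [].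
  split; first by move=> u v uv; apply: (iso_inj FaI); rewrite /= uv.
  split; apply/seteqP; split=> [e|e].
  + move=> [[_ e2] [[v _ /= <-] [/= e2g _]]] <- /=.
    by rewrite /fibre /= vproj_add ?aL.2.
  + move=> eg; have [v av] : exists v, (F \o a) v = F e.
      by apply: (iso_surj FaI); rewrite /fibre /= (linear_proj FL) eg.
    exists (a v, vadd e (vopp (a v))); last by rewrite /= vsubK// aL.2.
    split; first by exists v.
    split; rewrite /fibre /= ?vproj_add ?vproj_opp ?aL.2//.
    rewrite (linear_add FL) ?vproj_opp ?aL.2// (fibrewise_linearN FL) -av /=.
    by rewrite vaddNr FaL.2.
  + by move=> [[v _ <-] [_ /(iso_ker Fsub FaI) ->]] /=; exact: fibre_linear0.
  + move=> ->; split; first by exists 0 => //; exact: fibre_linear0.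
    by rewrite /fibre /= vproj_zero (fibrewise_linear0 FL).
- apply: (fibre_linear_rank_iso FaL) => v Fav.
  apply: aI; rewrite (fibre_linear0 aL).
  have : [set vzero (EG E) g] (a v).
    by rewrite -HK; split; [exists v|split=> //; exact: aL.2].
  by [].
Qed.

(** The vertical part fills the whole of ker s_g: if phi (w, v) is in ker s_g
    then s (a v) = 0, and s o a is injective, so v = 0. *)
Lemma sbis_frame_pair g (phi : gframe E) : is_sbis_frame g phi ->
  bisection_pair g (fun v => phi (0, v)) (fun w => phi (w, 0)).
Proof.
move=> [phiI ver sumS sumT].
have phiL : fibre_linear g phi by exact: (iso_fibre_linear _ phiI).
have aL : fibre_linear g (fun v => phi (0, v)).
  split=> [c u v|u]; last exact: phiL.2.
  by rewrite -phiL.1; congr phi; congr pair; rewrite /= scaler0 addr0.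
have bL : fibre_linear g (fun w => phi (w, 0)).
  split=> [c u v|u]; last exact: phiL.2.
  by rewrite -phiL.1; congr phi; congr pair; rewrite /= scaler0 addr0.
have aI : injective (fun v => phi (0, v)) by move=> u v /(iso_inj phiI)[].
have sI := (direct_sum_ker srcL aL).2 (conj aI sumS).
split=> //; last exact: (direct_sum_ker tgtL aL).2 (conj aI sumT).
apply: (fibre_linear_iso bL) => // [w w0|e [eg se]].
  have: phi (w, 0) = phi 0 by rewrite w0 (fibre_linear0 phiL).
  by move/(iso_inj phiI) => [].
have [[w v] phie] := iso_surj phiI eg; exists w; rewrite -phie.
suff -> : v = 0 by [].
apply: (iso_ker (x := gsrc g) _ sI) => //=.
have : phi (w, v) = vadd (phi (w, 0)) (phi (0, v)).
  rewrite -(fibre_linearD phiL); congr phi; congr pair.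
    by rewrite /= addr0.
  by rewrite /= add0r.
rewrite phie => ewv; move: se.
rewrite ewv (linear_add srcL) ?phiL.2// (ver w).2 zero_vadd//.
by rewrite (linear_proj srcL) phiL.2.
Qed.

Lemma Fr_sbisP phi : Fr_sbis E phi ->
  exists g a b, bisection_pair g a b /\ phi = frame_of a b.
Proof.
move=> [g phig]; have ab := sbis_frame_pair phig.
exists g, (fun v => phi (0, v)), (fun w => phi (w, 0)); split=> //.
apply/funext => -[w v]; have [phiI _ _ _] := phig.
have phiL : fibre_linear g phi by exact: (iso_fibre_linear _ phiI).
rewrite /frame_of -(fibre_linearD phiL); congr phi; congr pair.
  by rewrite /= add0r.
by rewrite /= addr0.
Qed.

Section Pair.
Variables (g : arr G) (a : 'rV[R]_k -> EG E) (b : 'rV[R]_l -> EG E).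
Hypothesis ab : bisection_pair g a b.

Let aL : fibre_linear g a. Proof. by case: ab. Qed.
Let bI : is_linear_iso (ker_src g) b. Proof. by case: ab. Qed.
Let bL : fibre_linear g b.
Proof. by apply: (iso_fibre_linear _ bI) => e []. Qed.
Let sI : is_linear_iso (fibre (EM E) (gsrc g)) (vsrc \o a).
Proof. by case: ab. Qed.
Let tI : is_linear_iso (fibre (EM E) (gtgt g)) (vtgt \o a).
Proof. by case: ab. Qed.
Let bg w : ker_src g (b w). Proof. exact: (iso_in bI). Qed.

Lemma frame_of_hor v : frame_of a b (0, v) = a v.
Proof. by rewrite /frame_of /= (fibre_linear0 bL) vadd_zero// aL.2. Qed.

Lemma frame_of_ver w : frame_of a b (w, 0) = b w.
Proof. by rewrite /frame_of /= (fibre_linear0 aL) zero_vadd// bL.2. Qed.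

Lemma frame_of_base : frame_base (frame_of a b) = g.
Proof. by rewrite /frame_base frame_of_hor aL.2. Qed.

(** A vector e is a v + b w, where v is determined by s (a v) = s e, and b w is
    the remainder, which lies in ker s_g. *)
Lemma frame_of_sbis : is_sbis_frame g (frame_of a b).
Proof.
have lin : fibre_linear g (frame_of a b).
  split=> [c [w v] [w' v']|[w v]]; last by rewrite vproj_add ?aL.2 ?bL.2.
  rewrite /frame_of /= aL.1 bL.1 vscaleDr ?aL.2 ?bL.2//.
  by apply: (vaddACA (x := g)); rewrite ?vproj_scale ?aL.2 ?bL.2.
have horE : (fun v => frame_of a b (0, v)) = a by apply/funext/frame_of_hor.
split.
- apply: (fibre_linear_iso lin) => [u|[w v] wv0|e eg]; first exact: lin.2.
  + have v0 : v = 0.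
      apply: (iso_ker (x := gsrc g) _ sI) => //=.
      (* s kills the vertical part *)
      have := congr1 vsrc wv0.
      rewrite (linear_add srcL) ?aL.2 ?bL.2// (bg w).2 vsrc_zero vadd_zero//.
      by rewrite (linear_proj srcL) aL.2.
    move: wv0; rewrite v0 frame_of_ver => w0.
    by rewrite (iso_ker (x := g) _ bI w0)// => e [].
  + have [v av] : exists v, (vsrc \o a) v = vsrc e.
      by apply: (iso_surj sI); rewrite /fibre /= (linear_proj srcL) eg.
    have [w bw] : exists w, b w = vadd e (vopp (a v)).
      apply: (iso_surj bI); split.
        by rewrite /fibre /= vproj_add ?vproj_opp ?aL.2.
      rewrite (linear_add srcL) ?vproj_opp ?aL.2// (fibrewise_linearN srcL).
      by rewrite -av /= vaddNr (linear_proj srcL) aL.2.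
    by exists (w, v); rewrite /frame_of /= bw vsubK// aL.2.
- by move=> w; rewrite frame_of_ver.
- by rewrite horE; have [] := (direct_sum_ker srcL aL).1 sI.
- by rewrite horE; have [] := (direct_sum_ker tgtL aL).1 tI.
Qed.

(** * The structure maps in terms of pairs *)

Lemma sbis_tgt_frame_of :
  sbis_tgt E (frame_of a b) = (Rtrans (ginv g) \o b, vtgt \o a).
Proof.
rewrite /sbis_tgt; congr pair; apply/funext => u.
  by rewrite /sbis_tgt_c frame_of_base frame_of_ver.
by rewrite /sbis_tgt_b frame_of_hor.
Qed.

Let d : 'rV[R]_l -> 'rV[R]_k := sbis_d (frame_of a b).

(** The definition of d without inverse: right translation preserves the target,
    so the core-anchor of the core part at w is t (b w). *)
Lemma sbis_d_anchor w : vtgt (a (d w)) = vtgt (b w).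
Proof.
have [tc tb] := sbis_tgt_frame_of.
rewrite /d /sbis_d tb tc /= /core_anchor (vtgt_Rtrans (bg w)) ?(tgt_inv gpdG)//.
apply: (@pinvK _ _ _ _ (vtgt \o a)); rewrite inE.
have [v vE] : exists v, (vtgt \o a) v = vtgt (b w).
  by apply: (iso_surj tI); rewrite /fibre /= (linear_proj tgtL) bL.2.
by exists v.
Qed.

Lemma sbis_d_unique w v : vtgt (a v) = vtgt (b w) -> d w = v.
Proof. by rewrite -sbis_d_anchor => /(iso_inj tI). Qed.

(** The map kappa.  It equals phi (- w, d w): minus the vertical part, moved
    along the horizontal space into ker t_g.  Inverting its values in EG gives
    the vertical part of the inverse frame. *)
Definition ker_tgt_frame w : EG E := vadd (a (d w)) (vopp (b w)).

Lemma vsrc_ker_tgt_frame w : vsrc (ker_tgt_frame w) = vsrc (a (d w)).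
Proof.
rewrite (linear_add srcL) ?vproj_opp ?aL.2 ?bL.2// (fibrewise_linearN srcL).
by rewrite (bg w).2 vopp0 vadd_zero// (linear_proj srcL) aL.2.
Qed.

(** A vector phi (w, v) of ker t_g has t (a v) = t (b (- w)), that is,
    v = d (- w). *)
Lemma ker_tgt_frame_iso : is_linear_iso (ker_tgt g) ker_tgt_frame.
Proof.
have dlin (c : R) u v : d (c *: u + v) = c *: d u + d v.
  apply: sbis_d_unique; rewrite aL.1 bL.1.
  rewrite !(linear_add tgtL) ?vproj_scale ?aL.2 ?bL.2//.
  by rewrite !(linear_scale tgtL) !sbis_d_anchor.
have kL : fibre_linear g ker_tgt_frame.
  split=> [c u v|u]; last by rewrite vproj_add ?vproj_opp ?aL.2 ?bL.2.
  rewrite /ker_tgt_frame dlin aL.1 bL.1 /vopp !vscaleDr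
    ?vproj_scale ?aL.2 ?bL.2// !vscaleA [-1 * c]mulrC -!vscaleA.
  by apply: (vaddACA (x := g)); rewrite ?vproj_scale ?aL.2 ?bL.2.
apply: (fibre_linear_iso kL) => [w|w kw0|e [eg te]].
- split; first exact: kL.2.
  rewrite (linear_add tgtL) ?vproj_opp ?aL.2 ?bL.2// (fibrewise_linearN tgtL).
  by rewrite sbis_d_anchor vaddNr (linear_proj tgtL) bL.2.
- have abw : a (d w) = b w by apply: (vsub_eq0 _ _ kw0); rewrite ?aL.2 ?bL.2.
  have dw0 : d w = 0.
    by apply: (iso_ker (x := gsrc g) _ sI) => //=; rewrite abw (bg w).2.
  apply: (iso_ker (x := g) _ bI) => [e []//|].
  by rewrite -abw dw0 (fibre_linear0 aL).
- have [phiI _ _ _] := frame_of_sbis; have [[w v] wvE] := iso_surj phiI eg.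
  have dwv : d (- w) = v.
    apply: sbis_d_unique; rewrite (fibre_linearN bL) (fibrewise_linearN tgtL).
    apply: (vsub_eq0 (x := gtgt g)); rewrite ?voppK ?vproj_opp.
    all: rewrite ?(linear_proj tgtL) ?aL.2 ?bL.2//.
    by rewrite -(linear_add tgtL) ?aL.2 ?bL.2// -te -wvE.
  exists (- w).
  by rewrite /ker_tgt_frame dwv (fibre_linearN bL) voppK -wvE.
Qed.

Lemma inv_ker_tgt_iso :
  is_linear_iso (ker_src (ginv g)) (vinv \o ker_tgt_frame).
Proof.
have kI := ker_tgt_frame_iso.
have ksub : @ker_tgt _ _ _ _ _ _ E g `<=` fibre (EG E) g by move=> e [].
have kL := iso_fibre_linear ksub kI.
apply: (fibre_linear_iso (fibre_linear_comp invL kL)) => [w|w /= w0|e [eg se]].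
- have [kw tw] := iso_in kI w.
  split; first by rewrite /fibre /= (linear_proj invL) kw.
  by rewrite /= (src_inv gpdE) tw (src_inv gpdG).
- apply: (iso_ker ksub kI); rewrite -[LHS](invK gpdE) w0.
  by rewrite (fibrewise_linear0 invL) (invK gpdG).
- have [w wE] : exists w, ker_tgt_frame w = vinv e.
    apply: (iso_surj kI); split.
      by rewrite /fibre /= (linear_proj invL) eg (invK gpdG).
    by rewrite (tgt_inv gpdE) se (src_inv gpdG).
  by exists w; rewrite /= wE (invK gpdE).
Qed.

Lemma frame_of_opp w v :
  frame_of a b (- w, v + d w) = vadd (a v) (ker_tgt_frame w).
Proof.
rewrite /frame_of /= (fibre_linearD aL) (fibre_linearN bL) /ker_tgt_frame.
by rewrite vaddA ?vproj_opp ?aL.2 ?bL.2.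
Qed.

Lemma sbis_src_cE w :
  sbis_src_c (frame_of a b) w = Rtrans g (vinv (ker_tgt_frame w)).
Proof.
rewrite /sbis_src_c frame_of_base -[sbis_d _ w]add0r frame_of_opp.
rewrite (fibre_linear0 aL) zero_vadd//.
by rewrite vproj_add ?vproj_opp ?aL.2 ?bL.2.
Qed.

(** A form free of sums; together with the next three lemmas it characterises
    the source core part by the equation a (d w) . c = b w. *)
Lemma sbis_src_c_div w :
  sbis_src_c (frame_of a b) w = vmul (vinv (a (d w))) (b w).
Proof.
by rewrite sbis_src_cE Rtrans_inv_sub ?aL.2 ?sbis_d_anchor.
Qed.

Lemma sbis_src_c_tgt w :
  vtgt (sbis_src_c (frame_of a b) w) = vsrc (a (d w)).
Proof.
by rewrite sbis_src_c_div (tgt_mul gpdE) ?(src_inv gpdE) ?(tgt_inv gpdE)//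
  sbis_d_anchor.
Qed.

Lemma vmul_sbis_src_c w :
  vmul (a (d w)) (sbis_src_c (frame_of a b) w) = b w.
Proof.
rewrite sbis_src_c_div -{1}[a (d w)](invK gpdE) (mulKg gpdE)//.
by rewrite (src_inv gpdE) sbis_d_anchor.
Qed.

(** The first hypothesis identifies v with d w, so that to compute a source it
    is enough to exhibit v and c, without computing d. *)
Lemma sbis_src_c_unique w v c : vtgt (a v) = vtgt (b w) ->
  vsrc (a v) = vtgt c -> vmul (a v) c = b w ->
  sbis_src_c (frame_of a b) w = c.
Proof.
move=> vw avc cE.
by rewrite sbis_src_c_div (sbis_d_unique vw) -cE (mulKg gpdE).
Qed.

Lemma sbis_src_frame_of : sbis_src E (frame_of a b) =
  (sbis_src_c (frame_of a b), vsrc \o a).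
Proof.
congr pair; apply/funext => v.
by rewrite /sbis_src_b frame_of_hor.
Qed.

Lemma sbis_src_c_iso :
  is_linear_iso (core (gsrc g)) (sbis_src_c (frame_of a b)).
Proof.
rewrite core_ker_src -(inv_mul gpdG).
have -> : sbis_src_c (frame_of a b) = Rtrans g \o (vinv \o ker_tgt_frame).
  by apply/funext => w; rewrite sbis_src_cE.
by apply: Rtrans_iso (src_inv gpdG g); exact: inv_ker_tgt_iso.
Qed.

Lemma sbis_src_base : Fr_core_base E (sbis_src E (frame_of a b)).
Proof.
exists (gsrc g); rewrite sbis_src_frame_of.
by split=> //; exact: sbis_src_c_iso.
Qed.

Lemma sbis_tgt_c_iso : is_linear_iso (core (gtgt g)) (Rtrans (ginv g) \o b).
Proof.
rewrite core_ker_src -(mul_inv gpdG).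
by apply: Rtrans_iso => //; rewrite (tgt_inv gpdG).
Qed.

Lemma sbis_tgt_base : Fr_core_base E (sbis_tgt E (frame_of a b)).
Proof.
exists (gtgt g); rewrite sbis_tgt_frame_of.
by split=> //; exact: sbis_tgt_c_iso.
Qed.

Lemma sbis_inv_frame_of : sbis_inv E (frame_of a b) =
  frame_of (vinv \o a) (vinv \o ker_tgt_frame).
Proof.
apply/funext => -[w v]; rewrite /sbis_inv frame_of_opp (linear_add invL)//.
by rewrite vproj_add ?vproj_opp ?aL.2 ?bL.2.
Qed.

Lemma bisection_pair_inv :
  bisection_pair (ginv g) (vinv \o a) (vinv \o ker_tgt_frame).
Proof.
split; first exact: fibre_linear_comp.
- exact: inv_ker_tgt_iso.
- rewrite (src_inv gpdG); have -> // : vsrc \o (vinv \o a) = vtgt \o a.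
  by apply/funext => v /=; rewrite (src_inv gpdE).
- rewrite (tgt_inv gpdG); have -> // : vtgt \o (vinv \o a) = vsrc \o a.
  by apply/funext => v /=; rewrite (tgt_inv gpdE).
Qed.

End Pair.

Lemma bisection_pair_ker g a b w : bisection_pair g a b -> ker_src g (b w).
Proof. by case=> _ /iso_in. Qed.

(** * Sources and targets of inverses, products and units *)

(** With e = a (d w), the equation to check is
    e^-1 . (b w . 0_{g^-1}) = (kappa w)^-1.  Its left side is the source core
    part translated by g^-1, and the source core part is the translate of
    (kappa w)^-1 by g. *)
Lemma sbis_src_inv g a b : bisection_pair g a b ->
  sbis_src E (sbis_inv E (frame_of a b)) = sbis_tgt E (frame_of a b).
Proof.
move=> ab; have ab' := bisection_pair_inv ab.
rewrite (sbis_inv_frame_of ab) (sbis_src_frame_of ab') (sbis_tgt_frame_of ab).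
congr pair; apply/funext => w /=; last by rewrite (src_inv gpdE).
have bg := bisection_pair_ker w ab.
have bt : vtgt (Rtrans (ginv g) (b w)) = vtgt (b w).
  by rewrite (vtgt_Rtrans bg)// (tgt_inv gpdG).
have bc : vsrc (b w) = vtgt (g0 (ginv g)).
  by apply: (Rtrans_composable bg); rewrite (tgt_inv gpdG).
have anchor := sbis_d_anchor ab w.
(* a frame and its inverse have the same d *)
apply: (sbis_src_c_unique ab' (v := sbis_d (frame_of a b) w)) => /=.
- by rewrite !(tgt_inv gpdE) (vsrc_ker_tgt_frame ab).
- by rewrite (src_inv gpdE) anchor bt.
- rewrite /Rtrans (mulA gpdE) ?(src_inv gpdE)// -(sbis_src_c_div ab).
  rewrite -/(Rtrans (ginv g) _) (sbis_src_cE ab).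
  rewrite (Rtrans_invV (g := ginv g)) ?(src_inv gpdG)//.
  exact: (iso_in (inv_ker_tgt_iso ab)).
Qed.

Lemma sbis_tgt_inv g a b : bisection_pair g a b ->
  sbis_tgt E (sbis_inv E (frame_of a b)) = sbis_src E (frame_of a b).
Proof.
move=> ab; have ab' := bisection_pair_inv ab.
rewrite (sbis_inv_frame_of ab) (sbis_tgt_frame_of ab') (sbis_src_frame_of ab).
congr pair; apply/funext => w /=; last by rewrite (tgt_inv gpdE).
by rewrite (invK gpdG) (sbis_src_cE ab).
Qed.

Section Multiplication.
Variables (g h : arr G) (a a' : 'rV[R]_k -> EG E) (b b' : 'rV[R]_l -> EG E).
Hypotheses (ab : bisection_pair g a b) (ab' : bisection_pair h a' b').
Hypothesis st : sbis_src E (frame_of a b) = sbis_tgt E (frame_of a' b').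

Lemma hor_composable v : vsrc (a v) = vtgt (a' v).
Proof.
move: st; rewrite (sbis_src_frame_of ab) (sbis_tgt_frame_of ab') => -[_ E2].
exact: (congr1 (@^~ v) E2).
Qed.

Lemma ver_composable w : sbis_src_c (frame_of a b) w = Rtrans (ginv h) (b' w).
Proof.
move: st; rewrite (sbis_src_frame_of ab) (sbis_tgt_frame_of ab') => -[E1 _].
by rewrite E1.
Qed.

Lemma sbis_base_comp : gsrc g = gtgt h.
Proof.
have [aL _ _ _] := ab; have [aL' _ _ _] := ab'.
rewrite -(aL.2 0) -(aL'.2 0) -(linear_proj srcL) -(linear_proj tgtL).
by rewrite hor_composable.
Qed.

Let gh := sbis_base_comp.

Lemma sbis_mul_frame_of : sbis_mul E (frame_of a b) (frame_of a' b') =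
  frame_of (fun v => vmul (a v) (a' v)) (Rtrans h \o b).
Proof.
apply/funext => -[w v]; rewrite /sbis_mul (frame_of_base ab') /=.
by rewrite (frame_of_hor ab) (frame_of_hor ab') (frame_of_ver ab).
Qed.

Lemma bisection_pair_mul :
  bisection_pair (gmul g h) (fun v => vmul (a v) (a' v)) (Rtrans h \o b).
Proof.
have [aL bI _ tI] := ab; have [aL' _ sI _] := ab'.
split.
- split=> [c u v|v]; last by rewrite vmul_proj ?hor_composable// aL.2 aL'.2.
  have sc : vsrc (vscale c (a u)) = vtgt (vscale c (a' u)).
    by rewrite (linear_scale srcL) (linear_scale tgtL) hor_composable.
  rewrite aL.1 aL'.1 vmul_add ?vproj_scale ?aL.2 ?aL'.2 ?hor_composable//.
  by rewrite vmul_scale ?hor_composable.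
- exact: Rtrans_iso.
- rewrite (src_mul gpdG)//.
  have -> // : vsrc \o (fun v => vmul (a v) (a' v)) = vsrc \o a'.
  by apply/funext => v /=; rewrite (src_mul gpdE)// hor_composable.
- rewrite (tgt_mul gpdG)//.
  have -> // : vtgt \o (fun v => vmul (a v) (a' v)) = vtgt \o a.
  by apply/funext => v /=; rewrite (tgt_mul gpdE)// hor_composable.
Qed.

Lemma sbis_tgt_mul :
  sbis_tgt E (sbis_mul E (frame_of a b) (frame_of a' b')) =
  sbis_tgt E (frame_of a b).
Proof.
rewrite sbis_mul_frame_of (sbis_tgt_frame_of bisection_pair_mul).
rewrite (sbis_tgt_frame_of ab); congr pair; apply/funext => u /=.
  have bg := bisection_pair_ker u ab.
  rewrite (Rtrans_comp bg)// ?(tgt_inv gpdG) ?(src_mul gpdG)//.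
  by rewrite (mul_inv_mul gpdG).
by rewrite (tgt_mul gpdE)// hor_composable.
Qed.

(** With c and c' the source core parts of the factors, composability gives
    b' w = c . 0_h, and both factors and the product have the same d; then
    a (d w) . a' (d w) . c' = a (d w) . b' w = a (d w) . c . 0_h = b w . 0_h. *)
Lemma sbis_src_mul :
  sbis_src E (sbis_mul E (frame_of a b) (frame_of a' b')) =
  sbis_src E (frame_of a' b').
Proof.
rewrite sbis_mul_frame_of (sbis_src_frame_of bisection_pair_mul).
rewrite (sbis_src_frame_of ab'); congr pair; apply/funext => w /=; last first.
  by rewrite (src_mul gpdE)// hor_composable.
have bg := bisection_pair_ker w ab; have bg' := bisection_pair_ker w ab'.
pose d := sbis_d (frame_of a b) w.
have dd' : sbis_d (frame_of a' b') w = d.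
  apply: (sbis_d_unique ab'); rewrite -hor_composable -(sbis_src_c_tgt ab).
  by rewrite ver_composable (vtgt_Rtrans bg') ?(tgt_inv gpdG).
have src_tgt : vsrc (a' d) = vtgt (sbis_src_c (frame_of a' b') w).
  by rewrite (sbis_src_c_tgt ab') dd'.
apply: (sbis_src_c_unique bisection_pair_mul (v := d)) => /=.
- rewrite (tgt_mul gpdE) ?hor_composable// (vtgt_Rtrans bg)//.
  exact: sbis_d_anchor ab w.
- by rewrite (src_mul gpdE)// hor_composable.
- rewrite -(mulA gpdE) ?hor_composable// -{2}dd' (vmul_sbis_src_c ab').
  rewrite -(Rtrans_inv bg').
  have core_h : vsrc (sbis_src_c (frame_of a b) w) = vtgt (g0 h).
    by rewrite vtgt_zero -gh (iso_in (sbis_src_c_iso ab) w).2.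
  rewrite -ver_composable /Rtrans (mulA gpdE) ?(sbis_src_c_tgt ab)//.
  by rewrite (vmul_sbis_src_c ab).
Qed.

End Multiplication.

Section Unit.
Variables (x : obj G) (f1 : 'rV[R]_l -> EG E) (f2 : 'rV[R]_k -> EM E).
Hypotheses (f1I : is_linear_iso (core x) f1).
Hypotheses (f2I : is_linear_iso (fibre (EM E) x) f2).

Let f2L : fibre_linear x f2. Proof. exact: (iso_fibre_linear _ f2I). Qed.

Lemma bisection_pair_unt : bisection_pair (gunt x) (vunt \o f2) f1.
Proof.
split; first exact: (fibre_linear_comp (vunt_linear E) f2L).
- by rewrite -core_ker_src.
- rewrite (src_unt gpdG); have -> // : vsrc \o (vunt \o f2) = f2.
  by apply/funext => v /=; rewrite (src_unt gpdE).
- rewrite (tgt_unt gpdG); have -> // : vtgt \o (vunt \o f2) = f2.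
  by apply/funext => v /=; rewrite (tgt_unt gpdE).
Qed.

Lemma sbis_unt_frame_of :
  sbis_unt E (f1, f2) = frame_of (vunt \o f2) f1.
Proof. by []. Qed.

Let f1_ker w : ker_src (gunt x) (f1 w).
Proof. by rewrite -core_ker_src; exact: (iso_in f1I). Qed.

Lemma sbis_tgt_unt : sbis_tgt E (sbis_unt E (f1, f2)) = (f1, f2).
Proof.
rewrite (sbis_tgt_frame_of bisection_pair_unt).
congr pair; apply/funext => u /=.
  by rewrite (inv_unt gpdG) (Rtrans_unt (f1_ker u))// (src_unt gpdG).
by rewrite (tgt_unt gpdE).
Qed.

(** The source core part c solves 1 . c = f1 u, where 1 is the unit at
    t (f1 u). *)
Lemma sbis_src_unt : sbis_src E (sbis_unt E (f1, f2)) = (f1, f2).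
Proof.
rewrite (sbis_src_frame_of bisection_pair_unt).
congr pair; apply/funext => u /=; last by rewrite (src_unt gpdE).
have [v vE] : exists v, f2 v = vtgt (f1 u).
  apply: (iso_surj f2I).
  by rewrite /fibre /= (linear_proj tgtL) (f1_ker u).1 (tgt_unt gpdG).
apply: (sbis_src_c_unique bisection_pair_unt (v := v)) => /=.
all: by rewrite ?(tgt_unt gpdE) ?(src_unt gpdE) ?(unt_mul gpdE).
Qed.

End Unit.

(** * Associativity, unit and inverse laws *)

Lemma sbis_mulA g h j a a' a'' b b' b'' : bisection_pair g a b ->
  bisection_pair h a' b' -> bisection_pair j a'' b'' ->
  sbis_src E (frame_of a b) = sbis_tgt E (frame_of a' b') ->
  sbis_src E (frame_of a' b') = sbis_tgt E (frame_of a'' b'') ->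
  sbis_mul E (frame_of a b) (sbis_mul E (frame_of a' b') (frame_of a'' b'')) =
  sbis_mul E (sbis_mul E (frame_of a b) (frame_of a' b')) (frame_of a'' b'').
Proof.
move=> ab ab' ab'' st st'.
rewrite (sbis_mul_frame_of ab ab') (sbis_mul_frame_of ab' ab'').
rewrite (sbis_mul_frame_of ab (bisection_pair_mul ab' ab'' st')).
rewrite (sbis_mul_frame_of (bisection_pair_mul ab ab' st) ab'').
congr frame_of; apply/funext => u /=.
  by rewrite (mulA gpdE)// ?(hor_composable ab ab')// (hor_composable ab' ab'').
rewrite (Rtrans_comp (bisection_pair_ker u ab))//.
- exact: sbis_base_comp ab ab' st.
- exact: sbis_base_comp ab' ab'' st'.
Qed.

Section UnitInverseLaws.
Variables (g : arr G) (a : 'rV[R]_k -> EG E) (b : 'rV[R]_l -> EG E).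
Hypothesis ab : bisection_pair g a b.

Let bg w : ker_src g (b w). Proof. exact: bisection_pair_ker ab. Qed.

Lemma sbis_mul_unt :
  sbis_mul E (frame_of a b) (sbis_unt E (sbis_src E (frame_of a b))) =
  frame_of a b.
Proof.
have [_ _ sI _] := ab; have ab' := bisection_pair_unt (sbis_src_c_iso ab) sI.
rewrite (sbis_src_frame_of ab) (sbis_mul_frame_of ab ab').
congr frame_of; apply/funext => u /=; first by rewrite (mul_unt gpdE).
by rewrite (Rtrans_unt (bg u)).
Qed.

Lemma sbis_unt_mul :
  sbis_mul E (sbis_unt E (sbis_tgt E (frame_of a b))) (frame_of a b) =
  frame_of a b.
Proof.
have [_ _ _ tI] := ab; have ab' := bisection_pair_unt (sbis_tgt_c_iso ab) tI.
rewrite (sbis_tgt_frame_of ab) (sbis_mul_frame_of ab' ab).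
congr frame_of; apply/funext => u /=; first by rewrite (unt_mul gpdE).
exact: Rtrans_inv.
Qed.

Lemma sbis_mul_inv :
  sbis_mul E (frame_of a b) (sbis_inv E (frame_of a b)) =
  sbis_unt E (sbis_tgt E (frame_of a b)).
Proof.
rewrite (sbis_inv_frame_of ab) (sbis_tgt_frame_of ab).
rewrite (sbis_mul_frame_of ab (bisection_pair_inv ab)).
rewrite sbis_unt_frame_of; congr frame_of.
by apply/funext => u; exact: (mul_inv gpdE).
Qed.

Lemma sbis_inv_mul :
  sbis_mul E (sbis_inv E (frame_of a b)) (frame_of a b) =
  sbis_unt E (sbis_src E (frame_of a b)).
Proof.
rewrite (sbis_inv_frame_of ab) (sbis_src_frame_of ab).
rewrite (sbis_mul_frame_of (bisection_pair_inv ab) ab).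
rewrite sbis_unt_frame_of; congr frame_of; apply/funext => u.
  exact: (inv_mul gpdE).
by rewrite (sbis_src_cE ab).
Qed.

End UnitInverseLaws.

End VBGroupoid.

Theorem theorem4p9 (R : realType) (p n : nat) (G : lie_groupoid R p n)
    (l k : nat) (E : vb_groupoid G l k) :
  is_groupoid (Fr_sbis E) (Fr_core_base E) (sbis_src E) (sbis_tgt E)
    (sbis_mul E) (sbis_unt E) (sbis_inv E).
Proof.
have pairP g a b : @bisection_pair _ _ _ G l k E g a b ->
    Fr_sbis E (frame_of a b).
  by exists g; exact: frame_of_sbis.
split.
- by move=> _ /Fr_sbisP[g [a [b [ab ->]]]]; exact: sbis_src_base ab.
- by move=> _ /Fr_sbisP[g [a [b [ab ->]]]]; exact: sbis_tgt_base ab.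
- move=> _ _ /Fr_sbisP[g [a [b [ab ->]]]] /Fr_sbisP[h [a' [b' [ab' ->]]]] st.
  rewrite (sbis_mul_frame_of ab ab').
  exact: pairP (bisection_pair_mul ab ab' st).
- by move=> [f1 f2] [x [/= f1I f2I]]; exact: pairP (bisection_pair_unt f1I f2I).
- move=> _ /Fr_sbisP[g [a [b [ab ->]]]]; rewrite (sbis_inv_frame_of ab).
  exact: pairP (bisection_pair_inv ab).
- move=> _ _ /Fr_sbisP[g [a [b [ab ->]]]] /Fr_sbisP[h [a' [b' [ab' ->]]]].
  exact: sbis_src_mul ab ab'.
- move=> _ _ /Fr_sbisP[g [a [b [ab ->]]]] /Fr_sbisP[h [a' [b' [ab' ->]]]].
  exact: sbis_tgt_mul ab ab'.
- by move=> [f1 f2] [x [/= f1I f2I]]; exact: sbis_src_unt f1I f2I.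
- by move=> [f1 f2] [x [/= f1I f2I]]; exact: sbis_tgt_unt f1I f2I.
- by move=> _ /Fr_sbisP[g [a [b [ab ->]]]]; exact: sbis_src_inv ab.
- by move=> _ /Fr_sbisP[g [a [b [ab ->]]]]; exact: sbis_tgt_inv ab.
- move=> _ _ _ /Fr_sbisP[g [a [b [ab ->]]]] /Fr_sbisP[h [a' [b' [ab' ->]]]]
    /Fr_sbisP[j [a'' [b'' [ab'' ->]]]].
  exact: sbis_mulA ab ab' ab''.
- by move=> _ /Fr_sbisP[g [a [b [ab ->]]]]; exact: sbis_mul_unt ab.
- by move=> _ /Fr_sbisP[g [a [b [ab ->]]]]; exact: sbis_unt_mul ab.
- by move=> _ /Fr_sbisP[g [a [b [ab ->]]]]; exact: sbis_mul_inv ab.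
- by move=> _ /Fr_sbisP[g [a [b [ab ->]]]]; exact: sbis_inv_mul ab.
Qed.
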